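(* Let $K$ be a compact Hausdorff space and let $\kappa$ be any cardinal number of uncountable cofinality. If $M$ is a nonempty compact and convex subspace of $P(K)$, then at least one of the following holds: (D1) there exists $\mu\in M$ such that $\chi(\mu,M)<\kappa$; (D2) there exists $\mu\in M$ such that $\operatorname{mt}(\mu)\geq\kappa$.
   Context: For a compact Hausdorff space $K$, a Radon measure on $K$ is a finite Borel measure $\mu$ with $\mu(B)=\sup\{\mu(F): F \text{ closed}, F\subseteq B\}$ for every Borel $B\subseteq K$. $P(K)$ is the set of all Radon probability measures on $K$, regarded as a subset of the dual Banach space $C(K)^*$ of $C(K)$ and equipped with the weak$^*$ topology; topological notions for subsets of $P(K)$ refer to this topology. For a topological space $X$ and $x\in X$, $\chi(x,X)$ is the minimal cardinality of a local base of $X$ at $x$; thus $\chi(\mu,M)$ is the character of $\mu$ in the subspace $M$. The Maharam type $\operatorname{mt}(\mu)$ of $\mu\in P(K)$ is the density character of the Banach space $L_1(\mu)$ (the least cardinality of a norm-dense subset). *)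

(* Defs.v *)
From HB Require Import structures.
From mathcomp Require Import all_boot all_order all_algebra.
From mathcomp Require Import all_classical all_reals all_analysis.
From mathcomp Require wochoice.

Set Implicit Arguments.
Unset Strict Implicit.
Unset Printing Implicit Defensive.

Import Order.TTheory GRing.Theory Num.Theory.
Import numFieldNormedType.Exports.

Local Open Scope classical_set_scope.
Local Open Scope ring_scope.
Local Open Scope card_scope.

Definition card_lt (T U : Type) (A : set T) (B : set U) : Prop :=
  (A #<= B) /\ ~ (B #<= A).

Definition least_card (T : Type) (F : set (set T)) (A : set T) : Prop :=
  F A /\ forall B, F B -> A #<= B.

(* A cardinal number is an initial ordinal: a well-ordered type all of whose
   proper initial segments have strictly smaller cardinality. Finite cardinals
   are included. *)
Definition initial_ordinal (kappa : Type) (le : rel kappa) : Prop :=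
  wochoice.well_order le /\
  forall x : kappa, card_lt [set y | ~~ le x y] [set: kappa].

Definition cofinal (kappa : Type) (le : rel kappa) (A : set kappa) : Prop :=
  forall x : kappa, exists2 y, A y & le x y.

Definition uncountable_cofinality (kappa : Type) (le : rel kappa) : Prop :=
  forall A : set kappa, cofinal le A -> ~ countable A.

Definition local_base (X : topologicalType) (x : X) (B : set (set X)) : Prop :=
  (forall U, B U -> open_nbhs x U) /\
  (forall V, nbhs x V -> exists2 U, B U & U `<=` V).

Definition is_character (X : topologicalType) (x : X) (B : set (set X)) : Prop :=
  least_card (local_base x) B.

(* The library's measurable types are pointed, whence [ptopologicalType]; a
   space carrying a probability measure is nonempty anyway. *)
Definition borel (K : ptopologicalType) := g_sigma_algebraType (@open K).

Definition radon (R : realType) (K : ptopologicalType)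
    (mu : probability (borel K) R) : Prop :=
  forall B : set (borel K), measurable B ->
    mu B = ereal_sup [set mu F | F in [set F | closed (F : set K) /\ F `<=` B]].

(* The dual of [C(K)] with its weak* topology is a topological and linear
   subspace of this space of all functions [C(K) -> R] with the topology of
   pointwise convergence. *)
Notation wstar R K := {ptws (continuousType K R) -> R}.

Definition functional (R : realType) (K : ptopologicalType)
    (mu : probability (borel K) R) : wstar R K :=
  fun f => \int[mu]_x f x.

(* [P(K)]. Library measures are functions on all subsets of [K], so two of them
   may differ on non-Borel sets only; they have the same functional. *)
Definition PK (R : realType) (K : ptopologicalType) : set (wstar R K) :=
  [set functional mu | mu in @radon R K].

Definition L1_dense (R : realType) (K : ptopologicalType)
    (mu : probability (borel K) R) (D : set (LspaceType1 mu)) : Prop :=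
  forall (f : LspaceType1 mu) (e : R), 0 < e ->
    exists2 g, D g & ('N[mu]_1[EFin \o ((f : borel K -> R) \- g)%R] < e%:E)%E.

Definition is_maharam_type (R : realType) (K : ptopologicalType)
    (mu : probability (borel K) R) (D : set (LspaceType1 mu)) : Prop :=
  least_card (@L1_dense R K mu) D.

(* Main.v *)
Require Import Defs.
From HB Require Import structures.
From mathcomp Require Import all_boot all_order all_algebra.
From mathcomp Require Import all_classical all_reals all_analysis.
From mathcomp Require Import measurable_realfun lra.

Set Implicit Arguments.
Unset Strict Implicit.
Unset Printing Implicit Defensive.

Import Order.TTheory GRing.Theory Num.Theory.
Import numFieldNormedType.Exports.

Local Open Scope classical_set_scope.
Local Open Scope ring_scope.
Local Open Scope card_scope.

(* Consider the pairs (S, mu) with mu in M and S a set of continuous functions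
   at mutual distance at least 1 in L_1(mu), ordered by enlarging S while
   keeping the distances between its old elements. As M is compact, chains have
   upper bounds, so Zorn yields a maximal pair. If some nu <> mu in M agreed
   with mu on S and on all |s - t| with s, t in S, say mu(f) <> nu(f), then for
   the midpoint lam of mu and nu, and s in S,
     lam(|f - s|) >= (|mu(f) - mu(s)| + |nu(f) - nu(s)|) / 2
                  >= |mu(f) - nu(f)| / 2,
   so (S, mu) could be enlarged by a multiple of f. Hence mu is determined in M
   by its values at these functions, and by compactness its character in M is
   countable or at most |S|, while the Maharam type of mu is at least |S|. *)

(** * Cardinals *)

Lemma card_le_of_inj (T U : Type) (A : set T) (B : set U) (f : T -> U) :
  (forall x, A x -> B (f x)) ->
  (forall x y, A x -> A y -> f x = f y -> x = y) -> A #<= B.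
Proof.
move=> fAB fI; suff [g] : $|{injfun A >-> B}| by exact: inj_card_le.
by apply/injfunPex; exists f => // x y /set_mem Ax /set_mem Ay; exact: fI.
Qed.

Lemma inj_of_card_le (T U : Type) (A : set T) (B : set U) (u : U) :
  A #<= B -> exists2 f : T -> U, forall x, A x -> B (f x) &
    forall x y, A x -> A y -> f x = f y -> x = y.
Proof.
move=> /card_leP[g].
have /injfunPex[f fAB fI] : $|{injfun A >-> B}| by squash (valLR u g).
by exists f => // x y /mem_set Ax /mem_set Ay; exact: fI.
Qed.

(* A maximal set of choice functions that pairwise differ at every member of
   [F] restricts onto some member, which therefore injects into all others. *)
Lemma least_card_exists (T : Type) (F : set (set T)) :
  F !=set0 -> exists A, least_card F A.
Proof.
move=> [A0 FA0].
pose matching (X : set (set T -> T)) :=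
  (forall x, X x -> forall A, F A -> A (x A)) /\
  (forall x y, X x -> X y -> forall A, F A -> x A = y A -> x = y).
have [|X [[Xin Xinj] Xmax]] := @Zorn_bigcup _ matching.
  move=> G GP Gtot; split=> [x [X GX Xx] A FA|x y [X GX Xx] [Y GY Yy] A FA].
    by have [Xin _] := GP _ GX; exact: (Xin x Xx A FA).
  have [XY|YX] := Gtot _ _ GX GY.
    by have [_] := GP _ GY; apply=> //; exact: XY.
  by have [_] := GP _ GX; apply=> //; exact: YX.
have [[A [FA surjA]]|nosurj] :=
    pselect (exists A, F A /\ forall a, A a -> exists2 x, X x & x A = a).
  exists A; split=> // B FB.
  have AX : A #<= X.
    apply: (@card_le_trans _ _ _ ((fun x => x A) @` X)).
      by apply: subset_card_le => a /surjA.
    exact: card_image_le.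
  apply: card_le_trans AX _.
  apply: (@card_le_of_inj _ _ _ _ (fun x => x B)) => [x Xx|x y Xx Xy xy].
    exact: (Xin _ Xx _ FB).
  exact: Xinj FB xy.
(* If [X] restricts onto no member of [F], each member has a point that [X] misses. Outside [F] any
   point will do; one exists, since otherwise [A0] would be empty and vacuously covered. The choice
   function [z] through missed points then enlarges [X]. *)
have miss A : exists a, F A -> A a /\ forall x, X x -> x A <> a.
  have [FA|nFA] := pselect (F A); last first.
    have [a _] : exists a : T, True.
      apply: contrapT => noT; apply: nosurj; exists A0; split=> // a.
      by exfalso; apply: noT; exists a.
    by exists a.
  apply: contrapT => noa; apply: nosurj; exists A; split=> // a Aa.
  apply: contrapT => nox; apply: noa; exists a => _; split=> // x Xx.
  by move=> xa; apply: nox; exists x.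
have [z zP] := choice miss.
exfalso; apply: (Xmax (X `|` [set z])).
  split=> [x Xx|/(_ z (or_intror erefl)) Xz]; first by left.
  by have [_ /(_ _ Xz)] := zP _ FA0.
split=> [x [Xx|->] A FA|x y [Xx|->] [Xy|->] A FA xy //].
- exact: (Xin _ Xx _ FA).
- by have [] := zP _ FA.
- exact: Xinj FA xy.
- by have [_ /(_ _ Xx)/(_ xy)] := zP _ FA.
- by have [_ /(_ _ Xy)/(_ (esym xy))] := zP _ FA.
Qed.

(** Least cardinals compare subsets of one type, so both sets are first copied into [T + U];
    whichever copy is least injects into the other. *)
Lemma card_le_total (T U : Type) (A : set T) (B : set U) : A #<= B \/ B #<= A.
Proof.
have inlE : (@inl T U) @` A #= A by apply: inj_card_eq => x y _ _ [].
have inrE : (@inr T U) @` B #= B by apply: inj_card_eq => x y _ _ [].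
have [|C [[]->]] :=
    @least_card_exists (T + U) [set inl @` A; inr @` B].
- by exists (inl @` A); left.
- move=> /(_ (inr @` B) (or_intror erefl)).
  by rewrite (card_le_eql inlE) (card_le_eqr inrE); left.
- move=> /(_ (inl @` A) (or_introl erefl)).
  by rewrite (card_le_eql inrE) (card_le_eqr inlE); right.
Qed.

(* Zorn on the injections [B * B -> B] with [B] an infinite subset of [A]: if
   [A \ B] still contained a copy of [B], three disjoint parts of that copy
   would accommodate the pairs outside [B * B]. *)
Lemma card_setX_infinite (T : Type) (A : set T) :
  infinite_set A -> A `*` A #<= A.
Proof.
move=> Ainf; have [a0 Aa0] := infinite_setN0 Ainf.
have [g gA gI] := inj_of_card_le a0 (proj1 (infiniteP A) Ainf).
have [c _ cI] : exists2 c : nat * nat -> nat, forall p, setT p -> setT (c p) &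
    forall p q, setT p -> setT q -> c p = c q -> p = q.
  by apply: (inj_of_card_le 0%N); have /card_eqPle[] := card_nat2.
pose good (Bf : set T * (T -> T -> T)) := [/\ Bf.1 `<=` A, infinite_set Bf.1,
  forall x y, Bf.1 x -> Bf.1 y -> Bf.1 (Bf.2 x y) &
  forall x y x' y', Bf.1 x -> Bf.1 y -> Bf.1 x' -> Bf.1 y' ->
    Bf.2 x y = Bf.2 x' y' -> x = x' /\ y = y'].
(* The second component is arbitrary off its domain, so this is only a preorder. *)
pose ext (s t : {Bf | good Bf}) := `[< (sval s).1 `<=` (sval t).1 /\
  forall x y, (sval s).1 x -> (sval s).1 y ->
    (sval t).2 x y = (sval s).2 x y >].
have extR t : ext t t by apply/asboolP; split=> x y.
have extT r s t : ext r s -> ext s t -> ext r t.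
  move=> /asboolP[rs rsE] /asboolP[st stE]; apply/asboolP.
  split=> [x /rs/st//|x y rx ry]; rewrite stE ?rsE //; exact: rs.
have [r rK] : exists r : T -> nat, forall n, r (g n) = n.
  have /choice[r rP] : forall x, exists m, (exists n, x = g n) -> x = g m.
    move=> x; have [[n xn]|nx] := pselect (exists n, x = g n).
      by exists n.
    by exists 0%N.
  exists r => n; have := rP (g n) (ex_intro _ n erefl).
  by move=> /gI <-.
(* Starting point for Zorn: a copy of the naturals in [A], paired through [c]. *)
have good0 : good (range g, fun x y => g (c (r x, r y))).
  split=> /=.
  - by move=> _ [n _ <-]; exact: gA.
  - apply/infiniteP; apply: (@card_le_of_inj _ _ _ _ g) => [n _|//].
    by exists n.
  - by move=> x y _ _; exists (c (r x, r y)).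
  - move=> _ _ _ _ [x _ <-] [y _ <-] [x' _ <-] [y' _ <-].
    by rewrite !rK => /(gI _ _ I I)/(cI _ _ I I)[-> ->].
have [|[[B f] gBf] Bmax] :=
    @ZL_preorder {Bf | good Bf} (exist _ _ good0) ext extR extT.
  move=> C Ctot; have [[t0 Ct0]|C0] := pselect (exists t, C t); last first.
    by exists (exist _ _ good0) => s Cs; exfalso; apply: C0; exists s.
  pose BC := \bigcup_(t in C) (sval t).1.
  have two x y : BC x -> BC y ->
      exists2 t, C t & (sval t).1 x /\ (sval t).1 y.
    move=> [s Cs sx] [t Ct ty]; have [/asboolP[st _]|/asboolP[ts _]] := Ctot _ _ Cs Ct.
      by exists t => //; split=> //; exact: st.
    by exists s => //; split=> //; exact: ts.
  (* The pairings of a chain agree where they overlap, so they glue; a pair in no common domain gets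
     the default [x]. *)
  have /choice[F FP] : forall p : T * T, exists z, forall t, C t ->
      (sval t).1 p.1 -> (sval t).1 p.2 -> z = (sval t).2 p.1 p.2.
    move=> [x y] /=.
    have [[t Ct [tx ty]]|no] :=
        pselect (exists2 t, C t & (sval t).1 x /\ (sval t).1 y); last first.
      by exists x => t Ct tx ty; exfalso; apply: no; exists t.
    exists ((sval t).2 x y) => s Cs sx sy.
    have [/asboolP[_ ->]|/asboolP[_ ->]] // := Ctot _ _ Cs Ct.
  have goodC : good (BC, fun x y => F (x, y)).
    split=> /=.
    - by move=> x [t _]; case: (svalP t) => + _ _ _; apply.
    - apply: (@sub_infinite_set _ (sval t0).1); first by move=> x tx; exists t0.
      by case: (svalP t0).
    - move=> x y xC yC; have [t Ct [tx ty]] := two _ _ xC yC.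
      by rewrite (FP _ t) //; exists t => //; case: (svalP t) => _ _ + _; apply.
    - move=> x y x' y' xC yC x'C y'C.
      have [t Ct [tx ty]] := two _ _ xC yC.
      have [t' Ct' [tx' ty']] := two _ _ x'C y'C.
      have [s Cs [ts t's]] : exists2 s, C s &
          (sval t).1 `<=` (sval s).1 /\ (sval t').1 `<=` (sval s).1.
        have [/asboolP[tt' _]|/asboolP[t't _]] := Ctot _ _ Ct Ct'.
          by exists t' => //; split.
        by exists t => //; split.
      rewrite (FP _ s) //=; [|exact: ts|exact: ts].
      rewrite (FP _ s) //=; [|exact: t's|exact: t's].
      by case: (svalP s) => _ _ _; apply; [exact: ts|exact: ts|exact: t's|exact: t's].
  exists (exist _ _ goodC) => s Cs; apply/asboolP; split=> /=.
    by move=> x sx; exists s.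
  by move=> x y sx sy; rewrite (FP _ s).
have /= [BA Binf fB fI] := gBf.
have [h0 h0B h0I] := inj_of_card_le a0 (proj1 (infiniteP B) Binf).
pose b n := h0 n.
have bB n : B (b n) by exact: h0B.
have bI m n : b m = b n -> m = n by exact: h0I.
(* Once [A] injects into [B], the pairing [f] on [B] codes all pairs from [A]. *)
suff [k kB kI] : exists2 k : T -> T, forall x, A x -> B (k x) &
    forall x y, A x -> A y -> k x = k y -> x = y.
  apply: (@card_le_of_inj _ _ _ _ (fun p => f (k p.1) (k p.2))).
    by move=> [x y] [/= Ax Ay]; apply: BA; apply: fB; exact: kB.
  move=> [x y] [x' y'] [/= Ax Ay] [/= Ax' Ay'].
  by move=> /fI[||||/(kI _ _ Ax Ax')-> /(kI _ _ Ay Ay')->//]; exact: kB.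
(* If the part of [A] outside [B] injects into [B], the tags [b 0] and [b 1] merge it with [B] into
   one injection of [A] into [B]. Otherwise [h] places a copy of [B] outside [B], and maximality is
   contradicted. *)
have [|] := card_le_total B (A `\` B) => /(inj_of_card_le a0)[h hB hI]; last first.
  exists (fun x => if x \in B then f (b 0%N) x else f (b 1%N) (h x)).
    move=> x Ax; case: ifPn => xB; first by apply: fB => //; exact: set_mem.
    by apply: fB => //; apply: hB; split=> //; move/mem_set; exact/negP.
  have hB' x : A x -> x \notin B -> B (h x).
    by move=> Ax xB; apply: hB; split=> //; move/mem_set; exact/negP.
  move=> x y Ax Ay; case: ifPn => xB; case: ifPn => yB.
  - by move=> /fI[]//; exact: set_mem.
  - by move=> /fI[||||/bI//]; [|exact: set_mem| |exact: hB'].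
  - by move=> /fI[||||/bI//]; [|exact: hB'| |exact: set_mem].
  - move=> /fI[||||_]; [by []|exact: hB'|by []|exact: hB'|apply: hI].
      by split=> //; move/mem_set; exact/negP.
    by split=> //; move/mem_set; exact/negP.
pose B' := B `|` h @` B.
have /choice[q qP] : forall x, exists y, B' x ->
    B y /\ (x = if x \in B then y else h y).
  move=> x; have [xB|xB] := boolP (x \in B).
    by exists x => _; split=> //; exact: set_mem.
  have [[y By <-]|nx] := pselect ((h @` B) x); first by exists y.
  by exists x => -[/mem_set|//]; rewrite (negPf xB).
have qB x : B' x -> B (q x) by move=> /qP[].
have qI x y : B' x -> B' y -> (x \in B) = (y \in B) -> q x = q y -> x = y.
  by move=> /qP[_ xE] /qP[_ yE] xy qxy; rewrite xE yE xy qxy.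
(* For pairs outside the square of [B], the tag has index 0 if only [x] is in [B], 1 if only [y] is,
   2 if neither is. Together with the pullbacks [q x] and [q y] to [B] it recovers the pair. *)
pose tag x y := b (if x \in B then 0%N else if y \in B then 1%N else 2%N).
pose f' x y := if (x \in B) && (y \in B) then f x y
               else h (f (tag x y) (f (q x) (q y))).
have hNB x : B x -> ~ B (h x) by move=> /hB[].
have cB x y : B' x -> B' y -> B (f (tag x y) (f (q x) (q y))).
  by move=> x' y'; apply: (fB); [exact: bB|apply: (fB); exact: qB].
have good' : good (B', f').
  split=> /=.
  - by move=> x [/BA//|[y By <-]]; have [] := hB _ By.
  - by apply: sub_infinite_set Binf => x; left.
  - move=> x y xB' yB'; rewrite /f'; case: ifPn => [/andP[/set_mem xB /set_mem yB]|_].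
      by left; exact: fB.
    by right; eexists; [exact: (cB _ _ xB' yB')|].
  - move=> x y x' y' xB yB xB' yB'; rewrite /f'.
    case: ifPn => [/andP[/set_mem Bx /set_mem By]|nxy];
      case: ifPn => [/andP[/set_mem Bx' /set_mem By']|nxy'].
    + exact: fI.
    + by move=> E; exfalso; apply: (hNB _ (cB _ _ xB' yB')); rewrite -E; exact: fB.
    + by move=> E; exfalso; apply: (hNB _ (cB _ _ xB yB)); rewrite E; exact: fB.
    + move=> /hI E.
      have /fI[||||tagE] := E (cB _ _ xB yB) (cB _ _ xB' yB').
      * exact: bB.
      * by apply: fB; exact: qB.
      * exact: bB.
      * by apply: fB; exact: qB.
      move=> /fI[||||qx qy]; [exact: qB..|].
      have [xx yy] : (x \in B) = (x' \in B) /\ (y \in B) = (y' \in B).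
        move: nxy nxy' tagE; rewrite /tag.
        by case: (x \in B); case: (y \in B); case: (x' \in B);
          case: (y' \in B) => // _ _ /bI.
      by split; exact: qI.
have /asboolP[/= B'B _] : ext (exist _ _ good') (exist _ (B, f) gBf).
  apply: Bmax; apply/asboolP; split=> /=; first by move=> x; left.
  by move=> x y /mem_set xB /mem_set yB; rewrite /f' xB yB.
by exfalso; apply: (hNB _ (bB 0%N)); apply: B'B; right; exists (b 0%N).
Qed.

Lemma card_seqX_nat (T : eqType) (A : set T) : infinite_set A ->
  [set s : seq T | forall x, x \in s -> A x] `*` [set: nat] #<= A.
Proof.
move=> Ainf; have [a0 Aa0] := infinite_setN0 Ainf.
have [g gA gI] := inj_of_card_le a0 (proj1 (infiniteP A) Ainf).
have [f fA fI0] := inj_of_card_le a0 (card_setX_infinite Ainf).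
have fI x y x' y' : A x -> A y -> A x' -> A y' ->
    f (x, y) = f (x', y') -> x = x' /\ y = y'.
  by move=> Ax Ay Ax' Ay' /(fI0 (x, y) (x', y') (conj Ax Ay) (conj Ax' Ay'))[].
(* The fold alone need not reveal the length of the sequence, so the length is coded alongside; on
   sequences of equal length the fold is injective. *)
pose code s := f (g (size s), foldr (fun x y => f (x, y)) a0 s).
have foldA s : (forall x, x \in s -> A x) ->
    A (foldr (fun x y => f (x, y)) a0 s).
  elim: s => //= x s IH xsA; apply: fA; split=> /=.
    by apply: xsA; rewrite mem_head.
  by apply: IH => y ys; apply: xsA; rewrite inE ys orbT.
have foldI s t : (forall x, x \in s -> A x) -> (forall x, x \in t -> A x) ->
    size s = size t -> foldr (fun x y => f (x, y)) a0 s =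
    foldr (fun x y => f (x, y)) a0 t -> s = t.
  elim: s t => [[]//|x s IH [//|y t]] /= xsA ytA [st].
  have [Ax sA] : A x /\ forall z, z \in s -> A z.
    by split=> [|z zs]; apply: xsA; rewrite inE ?eqxx ?zs ?orbT.
  have [Ay tA] : A y /\ forall z, z \in t -> A z.
    by split=> [|z zs]; apply: ytA; rewrite inE ?eqxx ?zs ?orbT.
  move=> /(fI _ _ _ _ Ax (foldA _ sA) Ay (foldA _ tA))[->].
  by move=> /(IH _ sA tA st) ->.
have codeA s : (forall x, x \in s -> A x) -> A (code s).
  by move=> sA; apply: fA; split; [exact: gA|exact: foldA].
apply: (@card_le_of_inj _ _ _ _ (fun p => f (g p.2, code p.1))).
  by move=> [s n] [/= sA _]; apply: fA; split; [exact: gA|exact: codeA].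
move=> [s n] [t m] [/= sA _] [/= tA _].
move=> /(fI _ _ _ _ (gA _ I) (codeA _ sA) (gA _ I) (codeA _ tA))[].
move=> /(gI _ _ I I) ->.
move=> /(fI _ _ _ _ (gA _ I) (foldA _ sA) (gA _ I) (foldA _ tA))[].
by move=> /(gI _ _ I I) st /(foldI _ _ sA tA st) ->.
Qed.

Lemma countable_seqX_nat (T : eqType) (A : set T) : countable A ->
  countable ([set s : seq T | forall x, x \in s -> A x] `*` [set: nat]).
Proof.
move=> Ac; have [f _ fI] := inj_of_card_le 0%N Ac.
apply: (@sub_countable _ _ _ [set: seq nat * nat]); last exact: countableP.
apply: (@card_le_of_inj _ _ _ _ (fun p => (map f p.1, p.2))) => //.
move=> [s n] [t m] [/= sA _] [/= tA _] [fst ->]; congr (_, _).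
have fI' : {in A &, injective f} by move=> x y /set_mem Ax /set_mem Ay; exact: fI.
by apply: (inj_in_map fI' _ _ fst); apply/allP => z; [move/sA|move/tA] => /mem_set.
Qed.

(** The whole of [kappa] is cofinal in itself. Reflexivity of [le] comes from the well-order: the
    singleton of [x] has a minimum. *)
Lemma uncountable_cofinality_uncountable (kappa : Type) (le : rel kappa) :
  initial_ordinal le -> uncountable_cofinality le -> ~ countable [set: kappa].
Proof.
move=> [wo _] cf; apply: cf => x; exists x => //.
have [|y [[/asboolP -> xle] _]] := wo (fun y => `[< y = x >]).
  by exists x; exact/asboolP.
by apply: xle; exact/asboolP.
Qed.

(** * Compact sets for pointwise convergence *)

(** The sets of approximate solutions of finitely many equations generate a proper filter containing
    [M]. A cluster point in [M] solves every equation exactly, because evaluation at a point is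
    continuous. *)
Lemma compact_solution (T : eqType) (R : realType) (M : set {ptws T -> R})
    (G : set (T * R)) :
  compact M ->
  (forall (l : seq (T * R)) n, (forall p, p \in l -> G p) ->
    exists2 nu, M nu & forall p, p \in l -> `|nu p.1 - p.2| < n.+1%:R^-1) ->
  exists2 nu, M nu & forall p, G p -> nu p.1 = p.2.
Proof.
move=> Mc approx.
pose E (l : seq (T * R)) (n : nat) := [set nu : {ptws T -> R} |
  M nu /\ forall p, p \in l -> `|nu p.1 - p.2| < n.+1%:R^-1].
pose F : set_system {ptws T -> R} := [set P | exists l n,
  (forall p, p \in l -> G p) /\ E l n `<=` P].
have FF : ProperFilter F.
  apply: Build_ProperFilter_ex; last split.
  - move=> P [l [n [lG EP]]]; have [nu Mnu nul] := approx l n lG.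
    by exists nu; exact: EP.
  - by exists [::], 0%N.
  - move=> P Q [l [n [lG EP]]] [m [k [mG EQ]]].
    exists (l ++ m), (maxn n k); split=> [p|nu [Mnu nulm]].
      by rewrite mem_cat => /orP[/lG|/mG].
    split; [apply: EP|apply: EQ]; split=> // p pl.
      apply: lt_le_trans (nulm p _) _; first by rewrite mem_cat pl.
      by rewrite lef_pV2 ?posrE// ler_nat ltnS leq_maxl.
    apply: lt_le_trans (nulm p _) _; first by rewrite mem_cat pl orbT.
    by rewrite lef_pV2 ?posrE// ler_nat ltnS leq_maxr.
  - move=> P Q PQ [l [n [lG EP]]]; exists l, n; split=> //.
    exact: subset_trans PQ.
have FM : F M by exists [::], 0%N; split=> // nu [].
have [nu [Mnu nuF]] := Mc F FF FM; exists nu => // -[g r] Ggr /=.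
apply/eqP; rewrite -subr_eq0 -normr_le0; apply/ler_addgt0Pl => e e0.
(* The cluster point is within [e / 2] of some point that solves the equation up to [n.+1%:R^-1],
   which is below [e / 2]. *)
have [n ne] : exists n, n.+1%:R^-1 < e / 2.
  exists (Num.truncn (e / 2)^-1); rewrite invf_plt ?posrE ?divr_gt0 ?ltr0n //.
  exact: truncnS_gt.
have FE : F (E [:: (g, r)] n).
  by exists [:: (g, r)], n; split=> // p; rewrite inE => /eqP->.
have nuB : nbhs nu [set ksi : {ptws T -> R} | `|nu g - ksi g| < e / 2].
  have := @proj_continuous T (fun=> R) g nu (ball (nu g) (e / 2)).
  by apply; apply: nbhsx_ballx; rewrite divr_gt0.
have [ksi [[_ /(_ (g, r) (mem_head _ _))/= ksir] /= ksinu]] := nuF _ _ FE nuB.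
rewrite addr0 -(subrKA (ksi g)) (splitr e) (le_trans (ler_normD _ _))// lerD// ltW//.
exact: lt_trans ne.
Qed.

Definition ptws_cylinder (T : eqType) (R : realType) (M : set {ptws T -> R})
    (mu : set_type M) (l : seq T) (n : nat) : set (set_type M) :=
  [set nu | forall g, g \in l -> `|set_val nu g - set_val mu g| < n.+1%:R^-1].

(** If no cylinder fits into an open [V'] around [mu], then [M] without [V'], which is compact,
    contains points approximating [mu] on any finite set of coordinates from [X]; directedness of
    [X] puts these coordinates into one cylinder. So [compact_solution] yields a point outside [V']
    agreeing with [mu] on all of [X], and that point is [mu]. *)
Lemma ptws_local_base (T : eqType) (R : realType) (M : set {ptws T -> R})
    (mu : set_type M) (X : set (seq T)) :
  compact M -> X !=set0 ->
  (forall l m, X l -> X m -> exists2 k, X k & {subset l ++ m <= k}) ->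
  (forall nu, M nu -> (forall l g, X l -> g \in l -> nu g = set_val mu g) ->
    nu = set_val mu) ->
  local_base mu [set ptws_cylinder mu p.1 p.2 | p in X `*` [set: nat]].
Proof.
move=> Mc [l0 Xl0] Xdir mu_det.
have valc : continuous (set_val : set_type M -> {ptws T -> R}).
  exact: initial_continuous.
split=> [_ [[l n] [/= Xl _] <-]|V].
  split; last by move=> g _ /=; rewrite subrr normr0 invr_gt0 ltr0n.
  rewrite openE => nu; elim: l {Xl} => [|g l IH] nul; first exact: filterE.
  have gc : continuous (fun ksi : set_type M => (set_val ksi : {ptws T -> R}) g).
    move=> ksi.
    exact: (continuous_comp (valc ksi) (@proj_continuous T (fun=> R) g _)).
  have evc : continuous (fun ksi : set_type M => `|set_val ksi g - set_val mu g|).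
    by move=> ksi; exact: (cvg_norm (cvgB (gc ksi) (cvg_cst _))).
  have IHl : nbhs nu (ptws_cylinder mu l n).
    by apply: IH => h hl; apply: nul; rewrite inE hl orbT.
  have nug : nbhs nu [set ksi | `|set_val ksi g - set_val mu g| < n.+1%:R^-1].
    apply: (evc nu [set x | x < n.+1%:R^-1]); apply: lt_nbhsl; apply: nul.
    by rewrite mem_head.
  apply: filterS2 nug IHl => ksi /= ksig ksil h; rewrite inE => /predU1P[->//|].
  exact: ksil.
rewrite nbhsE => -[_ [[V' oV' <-] V'mu] V'V].
apply: contrapT => noU.
have [|l n lG|nu [Mnu nV'] nuG] := @compact_solution T R (M `&` ~` V')
    [set (g, set_val mu g) | g in [set g | exists2 l, X l & g \in l]].
- by apply: compact_closedI => //; exact: open_closedC.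
- have [k Xk lk] : exists2 k, X k & {subset map fst l <= k}.
    elim: l lG => [|p l IH] lG; first by exists l0.
    have [|k Xk kl] := IH; first by move=> q ql; apply: lG; rewrite inE ql orbT.
    have [g [m Xm gm] gp] := lG p (mem_head _ _).
    have [j Xj jk] := Xdir _ _ Xm Xk.
    exists j => // h; rewrite /= inE => /predU1P[->|hl].
      by apply: jk; rewrite mem_cat -gp gm.
    by apply: jk; rewrite mem_cat kl ?orbT.
  apply: contrapT => nonu; apply: noU.
  exists (ptws_cylinder mu k n); first by exists (k, n).
  move=> ksi ksik; apply: V'V => /=; apply: contrapT => ksiV; apply: nonu.
  exists (set_val ksi); first by split=> //; exact: set_valP.
  move=> [a r] pl; have [g _ [ga gr]] := lG _ pl.
  rewrite -gr -ga /=; apply: ksik; apply: lk; rewrite ga.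
  by apply/mapP; exists (a, r).
apply: nV'; rewrite (mu_det nu) // => l g Xl gl.
by apply: (nuG (g, set_val mu g)); exists g => //; exists l.
Qed.

(** * Integrals of continuous functions *)

Section integral_continuous.
Context (R : realType) (K : ptopologicalType) (mu : probability (borel K) R).
Hypothesis K_compact : compact [set: K].

Lemma continuous_borel_measurable (f : K -> R) :
  continuous f -> measurable_fun [set: borel K] (f : borel K -> R).
Proof.
move=> /continuousP cf; apply: (measurability _ (RGenOpens.measurableE R)).
move=> _ [_ [a [b ->] <-]]; rewrite setTI; apply: sub_sigma_algebra.
exact/cf/interval_open.
Qed.

Lemma continuous_integrable (f : K -> R) :
  continuous f -> mu.-integrable [set: borel K] (EFin \o (f : borel K -> R)).
Proof.
move=> cf; apply: measurable_bounded_integrable => //.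
- by apply: le_lt_trans (ltry 1); rewrite -(probability_setT mu).
- exact: continuous_borel_measurable.
have /compact_bounded : compact (f @` setT).
  by apply: continuous_compact => //; exact: continuous_subspaceT.
by case=> M [Mreal MB]; exists M; split=> // x /MB xM y _; apply: xM; exists y.
Qed.

End integral_continuous.

(** An element of L_1 is a class whose underlying function is a chosen representative; hence the
    equality only almost everywhere. *)
Lemma ae_LspaceType1 d (T : measurableType d) (R : realType)
    (mu : {measure set T -> \bar R}) (f : T -> R) :
  mu.-integrable setT (EFin \o f) ->
  exists F : LspaceType1 mu, ae_eq mu setT (F : T -> R) f.
Proof.
move=> /integrableP[mf ifin].
have /measurable_EFinP mf' := mf.
pose m : {mfun T >-> measurableTypeR R} :=
  HB.pack (f : T -> measurableTypeR R)
    (isMeasurableFun.Build _ _ T (measurableTypeR R) f mf').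
pose q : {mfun_ mu, T >-> measurableTypeR R} :=
  \pi_({mfun_ mu, T >-> measurableTypeR R})%qT m.
have qf : ae_eq mu setT (q : T -> R) f.
  have : (repr q = m %[mod {mfun_ mu, T >-> measurableTypeR R}])%qT by rewrite reprK.
  by move=> /eqmodP /asboolP; exact.
have qfin : finite_norm mu 1 q.
  rewrite /finite_norm Lnorm1 (ae_eq_integral (fun x => `|(f x)%:E|)%E) //.
  - apply: measurableT_comp => //; apply/measurable_EFinP.
    exact: (@measurable_funPT _ _ _ _ (repr q)).
  - exact: measurableT_comp.
  by apply: filterS qf => x /(_ I) /= qx _; rewrite qx.
pose F : LspaceType1 mu :=
  HB.pack_for (LspaceType1 mu) q (isFinLebesgue.Build _ _ _ _ _ (@lexx _ _ 1%E) q qfin).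
by exists F.
Qed.

Lemma cts_dist_continuous (X : topologicalType) (R : realType)
    (f g : continuousType X R) : continuous (fun x => `|f x - g x|).
Proof.
by move=> x; apply: cvg_norm; apply: cvgB; exact: cts_fun.
Qed.

Definition cts_dist (X : topologicalType) (R : realType)
  (f g : continuousType X R) : continuousType X R :=
  mkcts (@cts_dist_continuous X R f g).

Lemma cts_scale_continuous (X : topologicalType) (R : realType) (c : R)
    (f : continuousType X R) : continuous (fun x => c * f x).
Proof. by move=> x; apply: cvgM; [exact: cvg_cst|exact: cts_fun]. Qed.

Definition cts_scale (X : topologicalType) (R : realType) (c : R)
  (f : continuousType X R) : continuousType X R :=
  mkcts (@cts_scale_continuous X R c f).

Section functional.
Context (R : realType) (K : ptopologicalType) (mu : probability (borel K) R).
Hypothesis K_compact : compact [set: K].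
Implicit Types f g : continuousType K R.

Lemma cts_integrable f : mu.-integrable [set: borel K] (EFin \o (f : borel K -> R)).
Proof. apply: continuous_integrable => //; exact: cts_fun. Qed.

Lemma functional_dist f g :
  `|functional mu f - functional mu g| <= functional mu (cts_dist f g).
Proof.
rewrite /functional -RintegralB //; [|exact: cts_integrable..].
apply: le_normr_Rintegral => //.
apply: (@continuous_integrable R K mu K_compact (fun x => f x - g x)) => x.
by apply: cvgB; exact: cts_fun.
Qed.

Lemma functional_dist_self f : functional mu (cts_dist f f) = 0.
Proof.
rewrite /functional (@eq_Rintegral _ _ _ mu setT (fun=> 0)) ?Rintegral_cst ?mul0r//.
by move=> x _ /=; rewrite /mkcts subrr normr0.
Qed.

Lemma functional_scale c f : functional mu (cts_scale c f) = c * functional mu f.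
Proof. by rewrite /functional -RintegralZl //; exact: cts_integrable. Qed.

(** Each [s] is sent to a member of [D] at L_1 distance below 1/2. Two elements with the same image
    would be at distance below 1, so this map is injective on [S]. *)
Lemma separated_card_le_L1_dense (S : set (continuousType K R))
    (D : set (LspaceType1 mu)) :
  (forall s t, S s -> S t -> s <> t -> 1 <= functional mu (cts_dist s t)) ->
  L1_dense D -> S #<= D.
Proof.
move=> Ssep Ddense.
have /choice[F Fae] := fun s => ae_LspaceType1 (cts_integrable s).
have half0 : 0 < 2^-1 :> R by rewrite invr_gt0.
have /choice[G GP] : forall s, exists G, D G /\
    ('N[mu]_1[EFin \o ((F s : borel K -> R) \- G)%R] < (2^-1)%:E)%E.
  by move=> s; have [G DG FG] := Ddense (F s) _ half0; exists G.
apply: (@card_le_of_inj _ _ _ _ G) => [s _|s t Ss St Gst]; first by have [] := GP s.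
apply: contrapT => st; have := Ssep s t Ss St st; apply/negP; rewrite -ltNge.
have [[_ Gs] [_ Gt]] := (GP s, GP t); rewrite -Gst in Gt.
have mF (H : LspaceType1 mu) : measurable_fun setT (H : borel K -> R).
  pose q : {mfun_ mu, borel K >-> measurableTypeR R} := H.
  exact: (@measurable_funPT _ _ _ _ (repr q)).
have mN (u v : borel K -> R) : measurable_fun setT u -> measurable_fun setT v ->
    measurable_fun setT (fun x => `|(u x - v x)%:E|%E).
  move=> mu' mv; apply: measurableT_comp => //; apply/measurable_EFinP.
  exact: measurable_funB.
rewrite -lte_fin /functional /Rintegral fineK; last first.
  by apply: integrable_fin_num => //; exact: (cts_integrable (cts_dist s t)).
rewrite (@ae_eq_integral _ _ _ mu setT (fun x => `|(F s x - F t x)%:E|%E)) //.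
- apply: (@le_lt_trans _ _
    (\int[mu]_x (`|(F s x - G s x)%:E| + `|(F t x - G s x)%:E|))%E).
    apply: ge0_le_integral => //.
    + exact: (mN _ _ (mF _) (mF _)).
    + by apply: emeasurable_funD; exact: (mN _ _ (mF _) (mF _)).
    move=> x _; rewrite -EFinD lee_fin (distrC (F t x)).
    exact: ler_distD.
  rewrite ge0_integralD //; [|exact: (mN _ _ (mF _) (mF _))..].
  rewrite [X in (_ < X%:E)%E](splitr 1) mul1r EFinD.
  by apply: lteD; move: Gs Gt; rewrite !Lnorm1.
- by have /integrableP[] := cts_integrable (cts_dist s t).
- exact: (mN _ _ (mF _) (mF _)).
apply: filterS2 (Fae s) (Fae t) => x /(_ I) Fs /(_ I) Ft _.
by rewrite Fs Ft.
Qed.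

End functional.

Lemma L1_dense_setT (R : realType) (K : ptopologicalType)
    (mu : probability (borel K) R) : L1_dense [set: LspaceType1 mu].
Proof.
move=> f e e0; exists f => //.
rewrite Lnorm1 (eq_integral (cst 0%E)) ?integral0 ?lte_fin //.
by move=> x _ /=; rewrite subrr normr0.
Qed.

(** * Maximal separated families *)

Lemma cts_distC (X : topologicalType) (R : realType) (f g : continuousType X R) :
  cts_dist f g = cts_dist g f.
Proof. by apply/continuousEP => x; rewrite /= /mkcts distrC. Qed.

Lemma convex_midpoint (R : realType) (T : Type) (M : set (T -> R))
    (mu nu : T -> R) :
  convex_set (M : set (convex_lmodType (T -> R))) -> M mu -> M nu ->
  M (fun f => 2^-1 * mu f + 2^-1 * nu f).
Proof.
move=> Mconv Mmu Mnu.
have h0 : 0 <= 2^-1 :> R by lra.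
have h1 : 2^-1 <= 1 :> R by lra.
have mid := set_mem (Mconv mu nu (Itv01 h0 h1) (mem_set Mmu) (mem_set Mnu)).
suff E : @eq (T -> R) (conv (Itv01 h0 h1) (mu : convex_lmodType (T -> R)) nu)
    (fun f => 2^-1 * mu f + 2^-1 * nu f) by exact: (@eq_ind (T -> R) _ M mid _ E).
apply/funext => f; rewrite /conv /=.
by have -> : unstable.onem 2^-1 = 2^-1 :> R by rewrite /unstable.onem; lra.
Qed.

Section separated.
Context (R : realType) (K : ptopologicalType) (M : set (wstar R K)).
Hypothesis K_compact : compact [set: K].
Hypothesis M_PK : M `<=` @PK R K.
Hypothesis M_nonempty : M !=set0.
Hypothesis M_compact : compact M.
Hypothesis M_convex :
  convex_set (M : set (convex_lmodType (continuousType K R -> R))).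

(** For [mu] in [P(K)], [mu (cts_dist s t)] is the distance of [s] and [t] in L_1 of [mu]. *)
Definition separated_by (S : set (continuousType K R)) (mu : wstar R K) :=
  forall s t, S s -> S t -> s <> t -> 1 <= mu (cts_dist s t).

Lemma separated_extension (S : set (continuousType K R)) (mu nu : wstar R K) :
  M mu -> M nu -> separated_by S mu ->
  (forall s, S s -> nu s = mu s) ->
  (forall s t, S s -> S t -> nu (cts_dist s t) = mu (cts_dist s t)) ->
  nu <> mu ->
  exists f lam, [/\ M lam, ~ S f, separated_by (f |` S) lam &
    forall s t, S s -> S t -> lam (cts_dist s t) = mu (cts_dist s t)].
Proof.
move=> Mmu Mnu Ssep nuS nuD numu.
have [f0 f0P] : exists f0, mu f0 <> nu f0.
  apply: contrapT => no; apply: numu; apply/funext => f.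
  by apply: contrapT => ?; apply: no; exists f; exact: nesym.
pose d := `|mu f0 - nu f0|.
have d0 : 0 < d by rewrite normr_gt0 subr_eq0; apply/eqP.
(* The factor makes [mu f] and [nu f] differ by exactly 2, so the midpoint [lam] keeps [f] at
   distance at least 1 from [S]. *)
pose f := cts_scale (2 / d) f0.
pose lam : wstar R K := fun g => 2^-1 * mu g + 2^-1 * nu g.
have [m _ mE] := M_PK Mmu; have [n _ nE] := M_PK Mnu.
have Mlam : M lam by exact: convex_midpoint.
have lamD s t : S s -> S t -> lam (cts_dist s t) = mu (cts_dist s t).
  by move=> Ss St; rewrite /lam nuD //; lra.
have far s : S s -> 1 <= lam (cts_dist f s).
  move=> Ss; have mufs : `|mu f - mu s| <= mu (cts_dist f s).
    by rewrite -mE functional_dist.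
  have nufs : `|nu f - mu s| <= nu (cts_dist f s).
    by rewrite -(nuS s Ss) -nE functional_dist.
  have fd : 2 = `|mu f - nu f|.
    rewrite -mE -nE !functional_scale // mE nE -mulrBr normrM -/d.
    by rewrite ger0_norm ?divr_ge0 ?ltW // divfK ?gt_eqF.
  have := ler_distD (mu s) (mu f) (nu f); rewrite -fd (distrC (mu s)) /lam.
  lra.
(* Otherwise [f] would be at distance at least 1 from itself. *)
have nSf : ~ S f.
  move=> /far; have [l _ <-] := M_PK Mlam.
  by rewrite functional_dist_self // ler10.
exists f, lam; split=> // s t [->|Ss] [->|St] st //.
- exact: far.
- by rewrite cts_distC; exact: far.
- by rewrite lamD //; exact: Ssep.
Qed.

Lemma maximal_separated : exists S mu, [/\ M mu, separated_by S mu &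
  forall nu, M nu -> (forall s, S s -> nu s = mu s) ->
    (forall s t, S s -> S t -> nu (cts_dist s t) = mu (cts_dist s t)) ->
    nu = mu].
Proof.
pose good (p : set (continuousType K R) * wstar R K) :=
  M p.2 /\ separated_by p.1 p.2.
(* Different functionals may agree at all these distances, so this too is only a preorder. *)
pose ext (p q : {p | good p}) := `[< (sval p).1 `<=` (sval q).1 /\
  forall s t, (sval p).1 s -> (sval p).1 t ->
    (sval q).2 (cts_dist s t) = (sval p).2 (cts_dist s t) >].
have extR p : ext p p by apply/asboolP; split.
have extT p q r : ext p q -> ext q r -> ext p r.
  move=> /asboolP[pq pqE] /asboolP[qr qrE]; apply/asboolP.
  split=> [x /pq/qr//|s t ps pt]; rewrite qrE ?pqE //; exact: pq.
have [mu0 Mmu0] := M_nonempty.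
have good0 : good (set0, mu0) by split.
have [|[[S mu] [/= Mmu Ssep]] Smax] :=
    @ZL_preorder {p | good p} (exist _ _ good0) ext extR extT; last first.
  exists S, mu; split=> // nu Mnu nuS nuD; apply: contrapT => numu.
  have [f [lam [Mlam nSf fSsep lamD]]] :=
    separated_extension Mmu Mnu Ssep nuS nuD numu.
  have good' : good (f |` S, lam) by [].
  have /asboolP[/= fS _] := Smax (exist _ _ good')
    (introT (asboolP _) (conj (fun s Ss => or_intror Ss) lamD)).
  by apply: nSf; apply: fS; left.
move=> C Ctot.
pose SC := \bigcup_(p in C) (sval p).1.
have two s t : SC s -> SC t -> exists2 p, C p & (sval p).1 s /\ (sval p).1 t.
  move=> [p Cp ps] [q Cq qt]; have [/asboolP[pq _]|/asboolP[qp _]] := Ctot _ _ Cp Cq.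
    by exists q => //; split=> //; exact: pq.
  by exists p => //; split=> //; exact: qp.
(* An upper bound of the chain must reproduce every distance fixed along it; [G] lists these
   requirements as equations. *)
pose G := [set gr : continuousType K R * R | exists p s t,
  [/\ C p, (sval p).1 s, (sval p).1 t &
    gr = (cts_dist s t, (sval p).2 (cts_dist s t))]].
have [l n lG|mu Mmu muG] := @compact_solution _ R M G M_compact.
  suff [mu Mmu mul] : exists2 mu, M mu & forall gr, gr \in l -> mu gr.1 = gr.2.
    by exists mu => // gr /mul ->; rewrite subrr normr0 invr_gt0 ltr0n.
  (* The empty list is treated apart, as the chain may be empty. *)
  have [->|[gr0 gr0l]] : l = [::] \/ exists gr, gr \in l.
  - by case: (l) => [|gr l']; [left|right; exists gr; rewrite mem_head].
  - by exists mu0.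
  (* The largest of the finitely many chain members involved satisfies all the equations exactly. *)
  suff [p _ pl] : exists2 p, C p & forall gr, gr \in l ->
      exists s t, [/\ (sval p).1 s, (sval p).1 t &
        gr = (cts_dist s t, (sval p).2 (cts_dist s t))].
    exists (sval p).2; first by case: (svalP p).
    by move=> gr /pl[s [t [_ _ ->]]].
  have [p0 [_ [_ [Cp0 _ _ _]]]] := lG _ gr0l.
  elim: l {gr0l} lG => [|gr l IH] lG; first by exists p0.
  have [|p Cp pl] := IH; first by move=> h hl; apply: lG; rewrite inE hl orbT.
  have [q [s [t [Cq qs qt grE]]]] := lG gr (mem_head _ _).
  have [/asboolP[pq pqE]|/asboolP[qp qpE]] := Ctot _ _ Cp Cq.
    exists q => // h; rewrite inE => /predU1P[->|/pl[u [v [pu pv ->]]]].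
      by exists s, t.
    by exists u, v; split; [exact: pq|exact: pq|rewrite pqE].
  exists p => // h; rewrite inE => /predU1P[->|/pl//].
  by exists s, t; split; [exact: qp|exact: qp|rewrite qpE].
have mup p s t : C p -> (sval p).1 s -> (sval p).1 t ->
    mu (cts_dist s t) = (sval p).2 (cts_dist s t).
  by move=> Cp ps pt; apply: (muG (_, _)); exists p, s, t.
have goodC : good (SC, mu).
  split=> // s t /= /two /[apply] -[p Cp [ps pt]] st; rewrite (mup p) //.
  by case: (svalP p) => _; apply.
exists (exist _ _ goodC) => p Cp; apply/asboolP; split=> /=.
  by move=> s ps; exists p.
by move=> s t ps pt; exact: mup.
Qed.

End separated.

(** * Character and Maharam type at a maximal pair *)

(** Adds to a finite list all its mutual distances, so that the coordinates determining [mu] are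
    indexed by finite sequences in [S], whose number is under control. *)
Definition dist_closure (X : topologicalType) (R : realType)
    (l : seq (continuousType X R)) : seq (continuousType X R) :=
  l ++ [seq cts_dist p.1 p.2 | p <- [seq (f, g) | f <- l, g <- l]].

Lemma dist_closure_sub (X : topologicalType) (R : realType)
    (l m : seq (continuousType X R)) :
  {subset l <= m} -> {subset dist_closure l <= dist_closure m}.
Proof.
move=> lm h; rewrite !mem_cat => /orP[/lm->//|].
move=> /mapP[_ /allpairsP[[f g] [/= fl gl ->]] ->]; apply/orP; right.
apply/mapP; exists (f, g) => //; apply/allpairsP.
by exists (f, g); split=> //; exact: lm.
Qed.

Theorem theorem2p2 (R : realType) (K : ptopologicalType)
    (K_compact : compact [set: K]) (K_hausdorff : hausdorff_space K)
    (kappa : Type) (le : rel kappa)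
    (kappa_cardinal : initial_ordinal le)
    (kappa_cf : uncountable_cofinality le)
    (M : set (wstar R K))
    (M_PK : M `<=` @PK R K)
    (M_nonempty : M !=set0)
    (M_compact : compact M)
    (M_convex : convex_set (M : set (convex_lmodType (continuousType K R -> R)))) :
  (exists mu : set_type M, exists2 B : set (set (set_type M)),
     is_character mu B & card_lt B [set: kappa]) \/
  (exists mu : probability (borel K) R, [/\ radon mu, M (functional mu) &
     exists2 D : set (LspaceType1 mu),
       is_maharam_type D & [set: kappa] #<= D]).
Proof.
have kappa_unc := uncountable_cofinality_uncountable kappa_cardinal kappa_cf.
have [S [mu [Mmu Ssep mu_max]]] :=
  maximal_separated K_compact M_PK M_nonempty M_compact M_convex.
have [kS|nkS] := pselect ([set: kappa] #<= S); [right|left].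
  have [m mrad mE] := M_PK _ Mmu.
  have [D [Ddense Dmin]] := @least_card_exists _ (@L1_dense R K m)
    (ex_intro _ _ (@L1_dense_setT R K m)).
  exists m; split=> //; first by rewrite mE.
  exists D; first by split.
  apply: card_le_trans kS _; apply: separated_card_le_L1_dense Ddense => //.
  by rewrite mE.
pose X := [set dist_closure l | l in [set l : seq _ | forall s, s \in l -> S s]].
pose mu' : set_type M := exist _ mu (mem_set Mmu).
pose B0 := [set ptws_cylinder mu' p.1 p.2 | p in X `*` [set: nat]].
have baseX : local_base mu' B0.
  apply: ptws_local_base => //.
  - by exists (dist_closure [::]), [::].
  - move=> _ _ [l lS <-] [m mS <-]; exists (dist_closure (l ++ m)).
      by exists (l ++ m) => // s; rewrite mem_cat => /orP[/lS|/mS].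
    move=> g; rewrite mem_cat => /orP[]; apply: dist_closure_sub => s sl;
      by rewrite mem_cat sl ?orbT.
  (* The lists [[:: s]] and [[:: s; t]] already carry the coordinates [s] and [cts_dist s t] that
     maximality asks for. *)
  move=> nu Mnu nuX; apply: mu_max => // [s Ss|s t Ss St].
    apply: (nuX (dist_closure [:: s])); last by rewrite mem_cat mem_head.
    by exists [:: s] => // u; rewrite inE => /eqP->.
  apply: (nuX (dist_closure [:: s; t])).
    by exists [:: s; t] => // u; rewrite !inE => /orP[] /eqP->.
  rewrite mem_cat; apply/orP; right; apply/mapP; exists (s, t) => //.
  by apply/allpairsP; exists (s, t); rewrite !inE !eqxx ?orbT.
pose P := [set l : seq (continuousType K R) | forall s, s \in l -> S s] `*` [set: nat].
have B0X : B0 #<= P.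
  have B0P : B0 `<=` (fun p => ptws_cylinder mu' (dist_closure p.1) p.2) @` P.
    by move=> _ [[_ n] [/= [l lS <-] _] <-]; exists (l, n).
  exact: card_le_trans (subset_card_le B0P) (card_image_le _ _).
(* The base is no larger than [P]. For finite [S] this is countable while [kappa] is not; for
   infinite [S] it is at most the cardinality of [S], into which [kappa] does not inject. *)
have kB0 : ~ ([set: kappa] #<= B0).
  move=> kB0; have [Sfin|Sinf] := pselect (finite_set S).
    apply: kappa_unc; apply: sub_countable (card_le_trans kB0 B0X) _.
    exact/countable_seqX_nat/finite_set_countable.
  by apply: nkS; apply: card_le_trans kB0 (card_le_trans B0X (card_seqX_nat Sinf)).
have [B [Bbase Bmin]] := @least_card_exists _ (local_base mu') (ex_intro _ _ baseX).
exists mu', B; first by split.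
have nkB : ~ ([set: kappa] #<= B).
  by move=> kB; apply: kB0; apply: card_le_trans kB (Bmin _ baseX).
by split=> //; have [] := card_le_total B [set: kappa].
Qed.
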